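(* For all integers $J\ge 0$ and $N\ge 0$, $$MO(-1,9J+4;27N+9)\equiv 0\pmod 3\qquad\text{and}\qquad MO(-1,9J+7;27N)\equiv 0\pmod 3.$$
   Context: For an integer $a$ and a nonnegative integer $t$, define $MO(a,t;n)$ by the formal power series identity $$\sum_{n\ge 0}MO(a,t;n)\,q^n=\sum_{1\le n_1<n_2<\cdots<n_t}\frac{q^{n_1+n_2+\cdots+n_t}}{\prod_{k=1}^t(1+aq^{n_k}+q^{2n_k})},$$ where each factor $1/(1+aq^{m}+q^{2m})$ is expanded as a power series in $q$ with integer coefficients. *)

(* Defs.v *)
From HB Require Import structures.
From mathcomp Require Import all_boot all_order all_algebra.
From mathcomp Require Import finmap boolp classical_sets functions.
From mathcomp Require Import cardinality fsbigop.

Set Implicit Arguments.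
Unset Strict Implicit.
Unset Printing Implicit Defensive.
Import Order.TTheory GRing.Theory Num.Theory.
Local Open Scope ring_scope.

(* The record wrapper keeps the Cauchy product apart from the pointwise
   product that [functions] puts on [nat -> R]. *)
Record fps (R : Type) := Fps { coef : nat -> R }.
Arguments Fps {R}.

HB.instance Definition _ R := gen_eqMixin (fps R).
HB.instance Definition _ R := gen_choiceMixin (fps R).

Lemma fpsP (R : Type) (f g : fps R) : coef f =1 coef g -> f = g.
Proof. by case: f g => [f] [g] /= /funext ->. Qed.

Section FpsZmod.
Variable R : zmodType.
Implicit Types f g h : fps R.

Definition fps_zero : fps R := Fps (fun=> 0).
Definition fps_opp f := Fps (fun n => - coef f n).
Definition fps_add f g := Fps (fun n => coef f n + coef g n).

Lemma fps_addA : associative fps_add.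
Proof. by move=> f g h; apply: fpsP => n; exact: addrA. Qed.
Lemma fps_addC : commutative fps_add.
Proof. by move=> f g; apply: fpsP => n; exact: addrC. Qed.
Lemma fps_add0 : left_id fps_zero fps_add.
Proof. by move=> f; apply: fpsP => n; exact: add0r. Qed.
Lemma fps_addN : left_inverse fps_zero fps_opp fps_add.
Proof. by move=> f; apply: fpsP => n; exact: addNr. Qed.

HB.instance Definition _ :=
  GRing.isZmodule.Build (fps R) fps_addA fps_addC fps_add0 fps_addN.

Lemma coef_fps0 n : coef (0 : fps R) n = 0. Proof. by []. Qed.
Lemma coef_fpsN f n : coef (- f) n = - coef f n. Proof. by []. Qed.
Lemma coef_fpsD f g n : coef (f + g) n = coef f n + coef g n.
Proof. by []. Qed.
Lemma coef_fpsB f g n : coef (f - g) n = coef f n - coef g n.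
Proof. by []. Qed.
Lemma coef_fps_sum I (r : seq I) (P : pred I) (F : I -> fps R) n :
  coef (\sum_(i <- r | P i) F i) n = \sum_(i <- r | P i) coef (F i) n.
Proof. exact: (big_morph (fun f => coef f n) (fun f g => coef_fpsD f g n) (coef_fps0 n)). Qed.

End FpsZmod.

Section FpsRing.
Variable R : comNzRingType.
Implicit Types f g h : fps R.

Definition fpsC (c : R) : fps R := Fps (fun n => if n == 0%N then c else 0).
Definition fps_one : fps R := fpsC 1.
Definition fps_mul f g :=
  Fps (fun n => \sum_(i < n.+1) coef f i * coef g (n - i)).

(* The ring laws are transferred from the truncations in [{poly R}]. *)
Definition fps_trunc n f : {poly R} := \poly_(i < n) coef f i.

Lemma coef_fps_mul (p q : {poly R}) n f g :
  (forall i, (i <= n)%N -> p`_i = coef f i) ->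
  (forall i, (i <= n)%N -> q`_i = coef g i) ->
  forall i, (i <= n)%N -> (p * q)`_i = coef (fps_mul f g) i.
Proof.
move=> pf qg i le_in; rewrite coefM; apply: eq_bigr => j _.
have le_ji : (j <= i)%N by rewrite -ltnS.
by rewrite pf ?qg //; [apply: leq_trans (leq_subr _ _) le_in|
  apply: leq_trans le_ji le_in].
Qed.

Lemma fps_truncP n f i : (i <= n)%N -> (fps_trunc n.+1 f)`_i = coef f i.
Proof. by move=> le_in; rewrite coef_poly ltnS le_in. Qed.

Lemma fps_mulA : associative fps_mul.
Proof.
move=> f g h; apply: fpsP => n; have tr := @fps_truncP n.
rewrite -(@coef_fps_mul _ _ n _ _ (tr f) (coef_fps_mul (tr g) (tr h))) //.
by rewrite -(@coef_fps_mul _ _ n _ _ (coef_fps_mul (tr f) (tr g)) (tr h)) // mulrA.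
Qed.
Lemma fps_mulC : commutative fps_mul.
Proof.
move=> f g; apply: fpsP => n; have tr := @fps_truncP n.
by rewrite -(coef_fps_mul (tr f) (tr g)) // -(coef_fps_mul (tr g) (tr f)) // mulrC.
Qed.
Lemma fps_mul1 : left_id fps_one fps_mul.
Proof.
move=> f; apply: fpsP => n /=.
by rewrite big_ord_recl /= mul1r subn0 big1 ?addr0 // => i _; rewrite mul0r.
Qed.
Lemma fps_mulDl : left_distributive fps_mul +%R.
Proof.
move=> f g h; apply: fpsP => n /=.
by rewrite -big_split; apply: eq_bigr => i _ /=; rewrite mulrDl.
Qed.
Lemma fps_one_neq0 : fps_one != 0.
Proof.
by apply/eqP => /(congr1 (fun f => coef f 0)) /= /eqP; rewrite oner_eq0.
Qed.

HB.instance Definition _ := GRing.Zmodule_isComNzRing.Build (fps R)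
  fps_mulA fps_mulC fps_mul1 fps_mulDl fps_one_neq0.

Lemma coef_fpsM f g n :
  coef (f * g) n = \sum_(i < n.+1) coef f i * coef g (n - i).
Proof. by []. Qed.
Lemma coef_fps1 n : coef (1 : fps R) n = (n == 0%N)%:R.
Proof. by rewrite /=; case: eqP. Qed.
Lemma coef_fpsCM c f n : coef (fpsC c * f) n = c * coef f n.
Proof.
rewrite coef_fpsM big_ord_recl /= subn0 big1 ?addr0 // => i _.
by rewrite mul0r.
Qed.

Definition fpsX : fps R := Fps (fun n => (n == 1%N)%:R).

Lemma coef_fpsXM f n :
  coef (fpsX * f) n = if n is n'.+1 then coef f n' else 0.
Proof.
rewrite coef_fpsM big_ord_recl mul0r add0r.
case: n => [|n]; first by rewrite big_ord0.
rewrite big_ord_recl /= mul1r big1 ?addr0 => [|i _]; last exact: mul0r.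
by rewrite subSS subn0.
Qed.

Lemma coef_fpsXnM f m n :
  coef (fpsX ^+ m * f) n = if (n < m)%N then 0 else coef f (n - m).
Proof.
elim: m n => [|m IHm] n; first by rewrite expr0 mul1r subn0.
by rewrite exprS -mulrA coef_fpsXM; case: n => // n; rewrite IHm ltnS subSS.
Qed.

Lemma coef_fpsXn m n : coef (fpsX ^+ m) n = (n == m)%:R.
Proof.
rewrite -[fpsX ^+ m]mulr1 coef_fpsXnM coef_fps1 subn_eq0.
by case: (ltngtP n m).
Qed.

Lemma coef_fpsX_lt f k n :
  coef f 0 = 0 -> (n < k)%N -> coef (f ^+ k) n = 0.
Proof.
move=> f0; elim: k n => // k IHk n lt_nk.
rewrite exprS coef_fpsM big1 // => -[[|i] lt_in] _ /=; first by rewrite f0 mul0r.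
rewrite IHk ?mulr0 //; move: lt_in lt_nk; case: n => // n _.
by rewrite subSS !ltnS; apply: leq_ltn_trans; apply: leq_subr.
Qed.

End FpsRing.

Notation "''q'" := (fpsX _) (at level 0, format "''q'") : ring_scope.

Section FpsUnit.
Variable R : comUnitRingType.
Implicit Types f g : fps R.

Definition fps_unit : {pred fps R} := fun f => coef f 0 \is a GRing.unit.

(* With [c] the constant term, f^-1 = c^-1 * \sum_k (1 - c^-1 * f)^k, where
   the terms k > n do not contribute to the coefficient of q^n. *)
Definition fps_inv f : fps R :=
  if coef f 0 \is a GRing.unit then
    let c := (coef f 0)^-1 in
    Fps (fun n => c * \sum_(k < n.+1) coef ((1 - fpsC c * f) ^+ k) n)
  else f.

Lemma fps_mulV : {in fps_unit, left_inverse 1 fps_inv *%R}.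
Proof.
move=> f uf; apply: fpsP => n; rewrite /fps_inv (uf : is_true (coef f 0 \is a _)).
set c := (coef f 0)^-1; set x := 1 - fpsC c * f.
have x0 : coef x 0 = 0 by rewrite coef_fpsB coef_fps1 coef_fpsCM mulVr ?subrr.
have cf : fpsC c * f = 1 - x by rewrite opprB addrC subrK.
transitivity (coef ((\sum_(k < n.+1) x ^+ k) * (1 - x)) n).
  rewrite -cf mulrCA coef_fpsCM [in RHS]coef_fpsM mulr_sumr coef_fpsM.
  apply: eq_bigr => -[i lt_in] _ /=; rewrite -mulrA; congr (_ * (_ * _)).
  rewrite coef_fps_sum -!(big_mkord predT (fun k => coef (x ^+ k) i)).
  rewrite (big_cat_nat (n := i.+1) (p := n.+1)) //= [X in _ = _ + X]big_nat.
  by rewrite [X in _ = _ + X]big1 ?addr0 // => k /andP[lt_ik _]; rewrite coef_fpsX_lt.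
rewrite mulrC -[1 - x]opprB mulNr -subrX1 opprB coef_fpsB coef_fpsX_lt //.
by rewrite subr0.
Qed.

Lemma fps_unitP f g : g * f = 1 -> fps_unit f.
Proof.
move/(congr1 (fun h => coef h 0)); rewrite coef_fpsM big_ord_recl big_ord0 addr0.
by move=> gf1; apply/unitrP; exists (coef g 0); split=> //; rewrite mulrC.
Qed.

Lemma fps_inv_out : {in [predC fps_unit], fps_inv =1 id}.
Proof. by move=> f nuf; rewrite /fps_inv ifN. Qed.

HB.instance Definition _ := GRing.ComNzRing_hasMulInverse.Build (fps R)
  fps_mulV fps_unitP fps_inv_out.

End FpsUnit.

Definition MO_term (a : int) (s : seq nat) : fps int :=
  'q ^+ (\sum_(m <- s) m) /
  \prod_(m <- s) (1 + a%:~R * 'q ^+ m + 'q ^+ (2 * m)).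

(* [path ltn 0 s] says that s is a list 1 <= n_1 < n_2 < ... *)
Definition MO_index (t : nat) : set (seq nat) :=
  [set s | path ltn 0 s && (size s == t)]%classic.

(* The sum of power series is taken coefficientwise; each coefficient is a
   finitely supported sum, see [MO_finite_support]. *)
Definition MO (a : int) (t n : nat) : int :=
  \sum_(s \in MO_index t) coef (MO_term a s) n.

Lemma MO_denom_unit (a : int) (s : seq nat) : path ltn 0 s ->
  \prod_(m <- s) (1 + a%:~R * 'q ^+ m + 'q ^+ (2 * m)) \is a @GRing.unit (fps int).
Proof.
move=> s_gt0; have {s_gt0} : all (ltn 0) s by apply: order_path_min s_gt0; exact: ltn_trans.
elim: s => [|m s IHs] /=; first by rewrite big_nil unitr1.
case/andP=> m_gt0 /IHs us; rewrite big_cons unitrM us andbT.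
rewrite qualifE /= /fps_unit !coef_fpsD coef_fps1 [_ * _]mulrC coef_fpsXnM m_gt0 coef_fpsXn.
by case: m m_gt0 => //= m _; rewrite addr0 mulnS addr0.
Qed.

Lemma MO_finite_support (a : int) (t n : nat) :
  finite_set (MO_index t `&` [set s | coef (MO_term a s) n <> 0])%classic.
Proof.
have fin (A : {fset seq nat}) (B : set (seq nat)) :
  (forall s, B s -> s \in A) -> finite_set B.
  by move=> BA; apply: (finite_subfset A) => s /BA.
apply: (fin [fset (map (@nat_of_ord n.+1) (tval u)) | u in {: t.-tuple 'I_n.+1}]%fset).
move=> s [/= /andP[_ /eqP sz_s] nz].
have le_sum : (\sum_(m <- s) m <= n)%N.
  by rewrite leqNgt; apply/negP => lt_n; apply: nz; rewrite -[LHS]/(coef (MO_term a s) n) /MO_term coef_fpsXnM lt_n.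
have sz : size (map (@inord n) s) == t by rewrite size_map sz_s.
apply/imfsetP; exists (Tuple sz) => //=.
rewrite -map_comp -[LHS]map_id; apply/eq_in_map => m ms /=.
rewrite inordK // ltnS; apply: leq_trans le_sum.
by rewrite (big_rem m) //= leq_addr.
Qed.

(* Main.v *)
From HB Require Import structures.
Require Import Defs.
From mathcomp Require Import all_boot all_order all_algebra all_field.
From mathcomp Require Import boolp classical_sets cardinality fsbigop.
From mathcomp Require Import zify ring.
Set Implicit Arguments.
Unset Strict Implicit.
Unset Printing Implicit Defensive.
Import GRing.Theory.
Local Open Scope ring_scope.

(* The numbers MO(a,t;n) are the coefficients of x^t q^n in the product over m
   of (1 + (a+x) q^m + q^(2m)) / (1 + a q^m + q^(2m)). Modulo 3 one may take
   a = 2, and a finite form of the Jacobi triple product then gives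
     psi(q) * \sum_n MO(2,t;n) q^n = \sum_k C(k+t,2t) q^(k(k+1)/2),
   where psi(q) = \sum_k q^(k(k+1)/2). For t = 9J+4 (resp. t = 9J+7) the right
   side is supported modulo 3 on exponents congruent to 10 (resp. 1) modulo 27,
   so the claim reduces to the vanishing modulo 3 of the coefficients of
   q^(27n+26) in 1/psi(q), or equivalently in psi(q)^26. With A(q) the part of
   psi with exponents divisible by 3, psi(q) = A(q)^3 + q psi(q)^9 modulo 3;
   extracting the exponents 3n+2 thus sends psi^2 to psi^6, hence psi^26 to
   psi^14, psi^14 to psi^10, and psi^10 = psi^9 psi to 0. *)

(** * Triangular numbers *)

Definition tri (k : nat) : nat := 'C(k.+1, 2).

Lemma triS k : tri k.+1 = (tri k + k.+1)%N.
Proof. by rewrite /tri binS bin1. Qed.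

Lemma tri_double k : (2 * tri k = k * k.+1)%N.
Proof. by elim: k => // k IHk; rewrite triS mulnDr IHk; nia. Qed.

Lemma leq_tri k : (k <= tri k)%N.
Proof. by case: k => // k; rewrite triS leq_addl. Qed.

Lemma tri_inj : injective tri.
Proof. by move=> i j eq_ij; have := tri_double i; have := tri_double j; nia. Qed.

(** * Congruence of series modulo q^K, and theta series *)

Section Congruence.
Variable R : comNzRingType.
Implicit Types f g h : fps R.

Definition fps_eqm K f g := forall n, (n < K)%N -> coef f n = coef g n.

Lemma fps_eqm_sym K f g : fps_eqm K f g -> fps_eqm K g f.
Proof. by move=> fg n /fg. Qed.

Lemma fps_eqm_trans K g f h : fps_eqm K f g -> fps_eqm K g h -> fps_eqm K f h.
Proof. by move=> fg gh n ltnK; rewrite fg // gh. Qed.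

Lemma fps_eqmM K f1 f2 g1 g2 :
  fps_eqm K f1 f2 -> fps_eqm K g1 g2 -> fps_eqm K (f1 * g1) (f2 * g2).
Proof.
move=> f12 g12 n ltnK; rewrite !coef_fpsM; apply: eq_bigr => -[i /= ltin] _.
by rewrite f12 ?g12 //; [apply: leq_ltn_trans (leq_subr _ _) ltnK |
  apply: leq_ltn_trans ltnK].
Qed.

Lemma fps_eqm_sum K I (r : seq I) (F G : I -> fps R) :
  (forall i, fps_eqm K (F i) (G i)) ->
  fps_eqm K (\sum_(i <- r) F i) (\sum_(i <- r) G i).
Proof.
by move=> FG n ltnK; rewrite !coef_fps_sum; apply: eq_bigr => i _; apply: FG.
Qed.

Lemma fps_eqm_XnM K f g h : f - g = 'q ^+ K * h -> fps_eqm K f g.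
Proof.
move=> fg n ltnK; apply/eqP; rewrite -subr_eq0 -coef_fpsB fg coef_fpsXnM.
by rewrite ltnK.
Qed.

(** The series \sum_k b_k q^(tri k): since [k <= tri k], no index beyond [n] reaches q^n. *)
Definition theta (b : nat -> R) : fps R :=
  Fps (fun n => \sum_(k < n.+1) b k * (n == tri k)%:R).

Lemma coef_theta_ge (b : nat -> R) n K : (n < K)%N ->
  coef (theta b) n = \sum_(k < K) b k * (n == tri k)%:R.
Proof.
move=> ltnK /=; rewrite -!(big_mkord predT (fun k => b k * (n == tri k)%:R)).
rewrite (big_cat_nat (n := n.+1) (p := K)) //= [X in _ = _ + X]big_nat.
rewrite [X in _ = _ + X]big1 ?addr0 // => k /andP[ltnk _].
by rewrite ltn_eqF ?mulr0 //; apply: leq_trans (leq_tri k).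
Qed.

Lemma theta_eqm (b : nat -> R) K :
  fps_eqm K (theta b) (\sum_(k < K) fpsC (b k) * 'q ^+ tri k).
Proof.
move=> n ltnK; rewrite (coef_theta_ge b ltnK) coef_fps_sum.
by apply: eq_bigr => k _; rewrite coef_fpsCM coef_fpsXn.
Qed.

Lemma coef_theta_tri (b : nat -> R) k : coef (theta b) (tri k) = b k.
Proof.
rewrite (@coef_theta_ge b _ (tri k).+1) //.
rewrite (bigD1 (Ordinal (leq_tri k : (k < (tri k).+1)%N))) //= eqxx mulr1.
rewrite big1 ?addr0 // => i /eqP ik; case: eqP => [eq_ki|]; last by rewrite mulr0.
by case: ik; apply: val_inj; apply/esym/tri_inj.
Qed.

Lemma coef_theta_eq0 (b : nat -> R) n :
  (forall k, n = tri k -> b k = 0) -> coef (theta b) n = 0.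
Proof.
move=> b0; rewrite /= big1 // => k _; case: eqP => [/b0 ->|]; first exact: mul0r.
by rewrite mulr0.
Qed.

End Congruence.

(** * A finite Jacobi triple product *)

Section FiniteJacobi.
Variable R : comNzRingType.

(* The coefficients in [\prod_(m <= M) (1 + y q^m + q^(2m)) = \sum_n jac M n D_n(y)]
   for the polynomials [D_n] with [y D_n = D_(n+1) + D_(n-1)], [D_0 = D_(-1) = 1];
   the convention [0.-1 = 0] implements the reflection [D_(-1) = D_0]. *)
Fixpoint jac (M n : nat) : fps R :=
  if M is M'.+1 then
    (1 + 'q ^+ (2 * M)) * jac M' n + 'q ^+ M * (jac M' n.-1 + jac M' n.+1)
  else (n == 0%N)%:R.

Lemma jac_gt M n : (M < n)%N -> jac M n = 0.
Proof.
elim: M n => [|M IHM] [|n] //= ltMn.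
by rewrite !IHM ?addr0 ?mulr0 ?addr0 //; lia.
Qed.

(** For [n <= M], [jac M n] is q^(tri n) times the q-binomial of 2M+1 over M-n; this is the ratio of
    consecutive terms with its denominator cleared. *)
Lemma jac_ratio M n :
  jac M n.+1 * (1 - 'q ^+ M.+1 * 'q ^+ n.+1) = ('q ^+ n.+1 - 'q ^+ M.+1) * jac M n.
Proof.
elim: M n => [|M IHM] n.
  by case: n => [|n] /=; rewrite ?subrr ?mul0r ?mulr0.
rewrite [jac M.+1 _]/= [jac M.+1 n]/= mulnC exprM.
have E1 := IHM n; have E2 := IHM n.+1.
have E0 : jac M n * (1 - 'q ^+ M.+1 * 'q ^+ n) = ('q ^+ n - 'q ^+ M.+1) * jac M n.-1.
  by case: n {E1 E2} => [|n]; rewrite ?IHM //= expr0 mulr1 mulrC.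
move: E0 E1 E2; rewrite !(exprS _ n.+1) !(exprS _ n) !(exprS _ M.+1).
set Q := 'q ^+ M.+1; set q := 'q; set u := q ^+ n.
set c0 := jac M n.-1; set c1 := jac M n; set c2 := jac M n.+1; set c3 := jac M n.+2.
(* The identity at [M.+1] is a linear combination of those at [M] for [n.-1],
   [n] and [n.+1], so that no division is needed. *)
move=> E0 E1 E2; apply/eqP; rewrite -subr_eq0; apply/eqP.
transitivity (Q * q * (c1 * (1 - Q * u) - (u - Q) * c0)
  + (1 + Q ^+ 2 * q) * (c2 * (1 - Q * (q * u)) - (q * u - Q) * c1)
  + Q * (c3 * (1 - Q * (q * (q * u))) - (q * (q * u) - Q) * c2)); first by ring.
by rewrite E0 E1 E2 !subrr !mulr0 !addr0.
Qed.

(** Modulo q^(M+1) the relation [jac_ratio] multiplies by q^(n+1) at each step, and these exponents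
    add up to [tri n]. *)
Lemma jac_eqm M n : fps_eqm M.+1 (jac M n) ('q ^+ tri n * jac M 0).
Proof.
elim: n => [|n IHn]; first by rewrite expr0 mul1r.
apply: (@fps_eqm_trans _ _ ('q ^+ n.+1 * jac M n)).
  apply: (@fps_eqm_XnM _ _ _ _ ('q ^+ n.+1 * jac M n.+1 - jac M n)).
  have /eqP := jac_ratio M n; rewrite -subr_eq0 => /eqP E.
  by apply/eqP; rewrite -subr_eq0 -[0]E; apply/eqP; ring.
by rewrite triS addnC exprD -mulrA; apply: fps_eqmM.
Qed.

(* [mo_elem a M t] is the coefficient of [x^t] in
   [\prod_(m <= M) (1 + a q^m + q^(2m) + x q^m)]. *)
Fixpoint mo_elem (a : int) (M t : nat) : fps R :=
  if M is M'.+1 then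
    (1 + a%:~R * 'q ^+ M + 'q ^+ (2 * M)) * mo_elem a M' t
    + 'q ^+ M * (if t is t'.+1 then mo_elem a M' t' else 0)
  else (t == 0%N)%:R.

(** With C(n+t,2t) read as the coefficient of x^t in D_n(2+x), this is (2+x) D_n = D_(n+1) +
    D_(n-1). *)
Lemma bin_cheb n t :
  (2 * 'C(n + t, t.*2) + (if t is t'.+1 then 'C(n + t', t'.*2) else 0) =
   'C(n.+1 + t, t.*2) + 'C(n.-1 + t, t.*2))%N.
Proof.
case: t => [|t]; first by rewrite !bin0.
case: n => [|n]; last by rewrite !doubleS !(addSn, addnS) !binS; lia.
by case: t => // t; rewrite !bin_small //; lia.
Qed.

(** Summation by parts; the convention [0.-1 = 0] leaves boundary terms only at the upper end. *)
Lemma sum_jac_shift (c D : nat -> fps R) K :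
  \sum_(n < K) (c n.-1 + c n.+1) * D n
  = \sum_(n < K) c n * (D n.+1 + D n.-1) + (c K * D K.-1 - c K.-1 * D K).
Proof.
elim: K => [|K IHK]; first by rewrite !big_ord0 subrr addr0.
by rewrite !big_ord_recr /= IHK; ring.
Qed.

(** Coefficient of x^t in the expansion of the product along the D_n(y), at y = 2+x. *)
Lemma mo_elem_jac M t K : (M < K)%N ->
  mo_elem 2 M t = \sum_(n < K) jac M n * ('C(n + t, t.*2))%:R.
Proof.
elim: M t K => [|M IHM] t [|K] // ltMK.
  rewrite big_ord_recl big1 ?addr0 /= => [|i _]; last by rewrite mul0r.
  by case: t => [|t]; rewrite mul1r // bin_small //; lia.
pose D n : fps R := ('C(n + t, t.*2))%:R.
have shift := @sum_jac_shift (jac M) D K.+1.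
rewrite !jac_gt ?mul0r ?subrr ?addr0 // in shift; try lia.
(* Multiplication by x: x D_n = D_(n+1) + D_(n-1) - 2 D_n. *)
have lhs : (if t is t'.+1 then mo_elem 2 M t' else 0) =
    \sum_(n < K.+1) jac M n * (D n.+1 + D n.-1 - 2 * D n).
  have e n : D n.+1 + D n.-1 - 2 * D n = (if t is t'.+1 then 'C(n + t', t'.*2) else 0)%:R.
    by rewrite /D -natrD -bin_cheb natrD natrM addrAC subrr add0r.
  under eq_bigr do rewrite e.
  case: t {shift D e} => [|t]; last by apply: IHM; lia.
  by rewrite big1 // => i _; rewrite mulr0.
rewrite [LHS]/= (IHM t K.+1) 1?ltnW // lhs.
transitivity (\sum_(n < K.+1) ((1 + 'q ^+ (2 * M.+1)) * (jac M n * D n))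
  + 'q ^+ M.+1 * \sum_(n < K.+1) jac M n * (D n.+1 + D n.-1)).
  rewrite !mulr_sumr -!big_split; apply: eq_bigr => n _ /=; rewrite -/(D n).
  by ring.
rewrite -shift mulr_sumr -big_split; apply: eq_bigr => n _ /=; rewrite -/(D n).
by ring.
Qed.

Lemma fpsC_nat n : n%:R = fpsC n%:R :> fps R.
Proof.
elim: n => [|n IHn]; apply: fpsP => i; first by rewrite /=; case: eqP.
by rewrite !mulrS coef_fpsD IHn /=; case: eqP; rewrite ?addr0.
Qed.

Lemma mo_elem_theta M t :
  fps_eqm M.+1 (mo_elem 2 M t) (jac M 0 * theta (fun n => ('C(n + t, t.*2))%:R)).
Proof.
rewrite (@mo_elem_jac M t M.+1) //.
apply: (@fps_eqm_trans _ _
    (\sum_(n < M.+1) 'q ^+ tri n * jac M 0 * ('C(n + t, t.*2))%:R)).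
  by apply: fps_eqm_sum => n; apply: fps_eqmM => //; apply: jac_eqm.
apply: (@fps_eqm_trans _ _ (jac M 0 *
    \sum_(n < M.+1) fpsC ('C(n + t, t.*2))%:R * 'q ^+ tri n)).
  move=> i _; congr (coef _ i); rewrite mulr_sumr; apply: eq_bigr => n _.
  by rewrite fpsC_nat; ring.
by apply: fps_eqmM => //; apply/fps_eqm_sym/theta_eqm.
Qed.

(** The case [t = 0] of [mo_elem_theta] makes [mo_elem 2 M 0] congruent to [jac M 0] times psi;
    cross-multiplying eliminates [jac M 0]. *)
Lemma theta_mo_elem M t :
  fps_eqm M.+1 (theta (fun=> 1) * mo_elem 2 M t)
    (mo_elem 2 M 0 * theta (fun n => ('C(n + t, t.*2))%:R)).
Proof.
apply: (@fps_eqm_trans _ _ (theta (fun=> 1) *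
    (jac M 0 * theta (fun n => ('C(n + t, t.*2))%:R)))).
  by apply: fps_eqmM => //; apply: mo_elem_theta.
rewrite mulrCA mulrA; apply: fps_eqmM => //; apply: fps_eqm_sym.
apply: (fps_eqm_trans (@mo_elem_theta M 0)); apply: fps_eqmM => // n _ /=.
by apply: eq_bigr => k _; rewrite bin0.
Qed.

End FiniteJacobi.

(** * From the defining sum of [MO] to a quotient of theta series *)

Section FpsMap.
Variables (R S : comNzRingType) (h : {rmorphism R -> S}).

Definition fps_map (f : fps R) : fps S := Fps (fun n => h (coef f n)).

Fact fps_map_is_zmod_morphism : zmod_morphism fps_map.
Proof. by move=> f g; apply: fpsP => n; apply: rmorphB. Qed.

Fact fps_map_is_monoid_morphism : monoid_morphism fps_map.
Proof.
split=> [|f g]; apply: fpsP => n.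
  by rewrite -[LHS]/(h (coef 1 n)) !coef_fps1 rmorph_nat.
by rewrite /= rmorph_sum; apply: eq_bigr => i _; rewrite rmorphM.
Qed.

HB.instance Definition _ :=
  GRing.isZmodMorphism.Build (fps R) (fps S) fps_map fps_map_is_zmod_morphism.
HB.instance Definition _ :=
  GRing.isMonoidMorphism.Build (fps R) (fps S) fps_map fps_map_is_monoid_morphism.

Lemma fps_mapX : fps_map 'q = 'q.
Proof. by apply: fpsP => n /=; rewrite rmorph_nat. Qed.

Lemma map_mo_elem a M t : fps_map (mo_elem R a M t) = mo_elem S a M t.
Proof.
elim: M t => [|M IHM] t; first by rewrite rmorph_nat.
rewrite /= rmorphD !rmorphM !rmorphD rmorphM rmorph_int !rmorphXn /= fps_mapX.
by rewrite rmorph1 IHM; case: t => [|t]; rewrite ?rmorph0 ?IHM.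
Qed.

End FpsMap.

Lemma mo_elem_den_unit (R : comUnitRingType) a M : mo_elem R a M 0 \is a GRing.unit.
Proof.
elim: M => [|M IHM] /=; first exact: unitr1.
rewrite mulr0 addr0 unitrM IHM andbT qualifE /= /fps_unit !coef_fpsD coef_fps1.
by rewrite mulrC coef_fpsXnM coef_fpsXn /= !addr0 unitr1.
Qed.

(** Splitting on whether the last entry is [M] gives the same recursion as [mo_elem]. *)
Fixpoint mo_list (M t : nat) : seq (seq nat) :=
  if M is M'.+1 then
    mo_list M' t ++ (if t is t'.+1 then [seq rcons s M | s <- mo_list M' t'] else [::])
  else if t is 0 then [:: [::]] else [::].

Lemma mem_mo_list M t s :
  (s \in mo_list M t) = [&& path ltn 0 s, size s == t & (last 0 s <= M)%N].
Proof.
elim: M t s => [|M IHM] t s.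
  case/lastP: s => [|s x]; first by case: t.
  rewrite rcons_path last_rcons leqn0 [RHS](_ : _ = false).
    by case: t => //=; rewrite inE; case: s.
  by case: x => [|x]; rewrite ?ltn0 !andbF.
rewrite /= mem_cat IHM; case/lastP: s => [|s x].
  case: t => [|t] //=; apply/negP => /mapP[s _ /(congr1 size)].
  by rewrite size_rcons.
rewrite rcons_path last_rcons size_rcons; case: t => [|t]; first by rewrite /= !andbF.
have -> : (rcons s x \in [seq rcons s M.+1 | s <- mo_list M t])
    = (x == M.+1) && (s \in mo_list M t).
  apply/mapP/andP => [[s' s'L /rcons_inj[-> ->]]|[/eqP-> sL]]; first by rewrite eqxx.
  by exists s.
rewrite IHM !eqSS; move: (path _ _ _) (last _ _) (size s) => p l z.
by case: p; case: (z == t) => /=; lia.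
Qed.

Lemma uniq_mo_list M t : uniq (mo_list M t).
Proof.
elim: M t => [|M IHM] [|t] //=; first by rewrite cats0.
rewrite cat_uniq IHM map_inj_uniq ?IHM ?andbT /=; last exact: rcons_injl.
apply/hasPn => _ /mapP[s _ ->]; rewrite /= mem_mo_list last_rcons.
by rewrite ltnn !andbF.
Qed.

Lemma MO_term_rcons a s x : path ltn 0 (rcons s x) ->
  MO_term a (rcons s x) * (1 + a%:~R * 'q ^+ x + 'q ^+ (2 * x)) = 'q ^+ x * MO_term a s.
Proof.
move=> px; have := MO_denom_unit a px; rewrite /MO_term !big_rcons /=.
rewrite unitrM => /andP[us ux]; rewrite invrM // [_^-1 * _]mulrC mulrA divrK //.
by rewrite exprD; ring.
Qed.

(** [mo_elem int a M 0] is a common denominator; each entry m of a list replaces the factor at m by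
    q^m. *)
Lemma sum_MO_term a M t :
  (\sum_(s <- mo_list M t) MO_term a s) * mo_elem int a M 0 = mo_elem int a M t.
Proof.
elim: M t => [|M IHM] t.
  case: t => [|t] /=; last by rewrite big_nil mul0r.
  by rewrite big_seq1 /MO_term !big_nil invr1 !mulr1.
rewrite /= mulr0 addr0 big_cat /= mulrDl mulrCA IHM; congr (_ + _).
case: t => [|t]; first by rewrite big_nil mul0r mulr0.
rewrite big_map -(IHM t) [LHS]mulrA [RHS]mulrA; congr (_ * _).
rewrite !mulr_suml mulr_sumr [LHS]big_seq [RHS]big_seq; apply: eq_bigr => s.
rewrite mem_mo_list => /and3P[ps _ sM]; apply: MO_term_rcons.
by rewrite rcons_path ps.
Qed.

Lemma MO_mo_list a t M n : (n <= M)%N ->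
  MO a t n = coef (\sum_(s <- mo_list M t) MO_term a s) n.
Proof.
move=> le_nM; rewrite coef_fps_sum /MO.
rewrite (fsbigE (mo_list M t)) ?uniq_mo_list //.
- rewrite big_seq_cond [RHS]big_seq_cond; apply: eq_bigl => s; rewrite andbT.
  rewrite andb_idr // mem_mo_list => /and3P[ps ss _].
  by rewrite inE /MO_index /= ps ss.
- by move=> s; rewrite /= mem_mo_list /MO_index /= => /and3P[-> ->].
(* A list with an entry above [M] has sum above [n], so its term starts beyond q^n. *)
move=> s /andP[ps ss]; rewrite mem_mo_list ps ss /= -ltnNge => ltM.
rewrite -[LHS]/(coef (MO_term a s) n) /MO_term coef_fpsXnM ifT //.
case/lastP: s ltM {ps ss} => // s x; rewrite last_rcons big_rcons => ltM.
by apply: leq_ltn_trans (leq_trans ltM (leq_addl _ _)).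
Qed.

(** Asking for a = 2 only in [fps R] admits a = -1 in characteristic 3. *)
Lemma MO_theta (R : comUnitRingType) a t : a%:~R = 2 :> fps R ->
  theta (fun=> 1) * Fps (fun n => (MO a t n)%:~R)
  = theta (fun n => ('C(n + t, t.*2))%:R) :> fps R.
Proof.
move=> a2; apply: fpsP => n; set X := Fps _; set d := fun n => _%:R.
have mo2 M s : mo_elem R a M s = mo_elem R 2 M s.
  by elim: M s => // M IHM s /=; rewrite a2 IHM; case: s => // s; rewrite IHM.
pose Y : fps R := fps_map (intmul 1) (\sum_(s <- mo_list n t) MO_term a s).
have XY : fps_eqm n.+1 X Y by move=> i lt_in; rewrite /= (@MO_mo_list a t n).
have Yt : mo_elem R a n t = Y * mo_elem R a n 0.
  have map_int := @map_mo_elem int R (intmul 1) a n.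
  by rewrite -(map_int t) -(map_int 0%N) -rmorphM sum_MO_term.
have u := mo_elem_den_unit R a n.
suff: fps_eqm n.+1 (theta (fun=> 1) * X) (theta d) by apply.
apply: (@fps_eqm_trans _ _ (theta (fun=> 1) * mo_elem R a n t * (mo_elem R a n 0)^-1)).
  by rewrite Yt mulrA mulrK //; apply: fps_eqmM.
rewrite -[theta d](mulKr u) [_^-1 * _]mulrC; apply: fps_eqmM => //.
by rewrite !mo2; apply: theta_mo_elem.
Qed.

(** * Extraction of residue classes of exponents, and Frobenius *)

Section Sections.
Variable R : comNzRingType.
Implicit Types f g : fps R.

Definition fps_dil k f : fps R :=
  Fps (fun n => if (k %| n)%N then coef f (n %/ k) else 0).

Lemma coef_fps_dilM k f n : (0 < k)%N -> coef (fps_dil k f) (k * n) = coef f n.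
Proof. by move=> k_gt0; rewrite /= dvdn_mulr // mulKn. Qed.

Lemma coef_fps_dil0 k f n : ~~ (k %| n)%N -> coef (fps_dil k f) n = 0.
Proof. by move=> /negbTE nk; rewrite /= nk. Qed.

Definition fps_sec k r f : fps R := Fps (fun n => coef f (k * n + r)).

Lemma coef_fps_sec k r f n : coef (fps_sec k r f) n = coef f (k * n + r).
Proof. by []. Qed.

Lemma fps_secD k r f g : fps_sec k r (f + g) = fps_sec k r f + fps_sec k r g.
Proof. by apply: fpsP. Qed.

Lemma fps_sec_dilM k r f g : (r < k)%N ->
  fps_sec k r (fps_dil k f * g) = f * fps_sec k r g.
Proof.
move=> lt_rk; have k_gt0 : (0 < k)%N by apply: leq_ltn_trans lt_rk.
apply: fpsP => n; rewrite [LHS]/= [RHS]/=.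
under eq_bigr => i _ do rewrite (fun_if (fun c => c * _)) mul0r.
rewrite -big_mkcond /=.
have mulP (j : 'I_n.+1) : (k * j < (k * n + r).+1)%N.
  by rewrite ltnS (leq_trans _ (leq_addr _ _)) // leq_pmul2l // -ltnS.
have divP (i : 'I_(k * n + r).+1) : (i %/ k < n.+1)%N.
  by rewrite ltn_divLR //; have := ltn_ord i; nia.
rewrite (reindex_onto (fun j => Ordinal (mulP j)) (fun i => Ordinal (divP i))) /=.
  apply: eq_big => j.
    by rewrite dvdn_mulr //=; apply/eqP/val_inj; rewrite /= mulKn.
  move=> _; rewrite mulKn //; congr (_ * coef g _).
  by rewrite mulnBr addnBAC // leq_pmul2l // -ltnS.
by move=> i ki; apply: val_inj; rewrite /= mulnC divnK.
Qed.

End Sections.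

Section Frobenius.
Variables (p : nat) (p_pr : prime p).
Implicit Types f g : fps 'F_p.

Lemma pchar_fps_Fp : p \in [pchar (fps 'F_p)].
Proof.
by rewrite inE p_pr fpsC_nat (pchar_Fp_0 p_pr); apply/eqP/fpsP => n /=; case: eqP.
Qed.

Lemma fpsCX c n : fpsC c ^+ n = fpsC (c ^+ n) :> fps 'F_p.
Proof.
elim: n => // n IHn; rewrite !exprS IHn; apply: fpsP => m; rewrite coef_fpsCM /=.
by case: eqP; rewrite ?mulr0.
Qed.

Lemma fps_Frobenius f : f ^+ p = fps_dil p f.
Proof.
have p_gt0 := prime_gt0 p_pr; apply: fpsP => n.
(* Additivity of Frobenius handles finite sums only, so the tail is split off; its p-th power starts
   beyond q^n. *)
have fE : f = \sum_(i < n.+1) fpsC (coef f i) * 'q ^+ i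
            + 'q ^+ n.+1 * Fps (fun m => coef f (m + n.+1)).
  apply: fpsP => m; rewrite coef_fpsD coef_fps_sum coef_fpsXnM.
  under eq_bigr do rewrite coef_fpsCM coef_fpsXn.
  case: ltnP => [lt_mn|le_nm]; last first.
    rewrite big1 ?add0r /= ?subnK // => i _.
    by rewrite gtn_eqF ?mulr0 //; apply: leq_trans le_nm.
  rewrite addr0 (bigD1 (Ordinal lt_mn)) //= eqxx mulr1 big1 ?addr0 // => i.
  by move/eqP=> ni; case: eqP => [mi|]; rewrite ?mulr0 //; case: ni; apply: val_inj.
have FrobD g h : (g + h) ^+ p = g ^+ p + h ^+ p.
  exact: (rmorphD (pFrobenius_aut pchar_fps_Fp)).
have Frob0 : 0 ^+ p = 0 :> fps 'F_p by rewrite expr0n gtn_eqF.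
rewrite {1}fE FrobD (big_morph _ FrobD Frob0) coef_fpsD coef_fps_sum.
rewrite [('q ^+ _ * _) ^+ p]exprMn -exprM coef_fpsXnM ifT ?addr0 ?leq_pmulr //.
have coefF i : coef ((fpsC (coef f i) * 'q ^+ i) ^+ p) n = coef f i * (n == i * p)%:R.
  rewrite exprMn -exprM fpsCX coef_fpsCM coef_fpsXn; congr (_ * _).
  by rewrite -[in RHS](expf_card (coef f i)) card_Fp.
under eq_bigr do rewrite coefF; rewrite /=; case: ifP => [/dvdnP[m ->]|np].
  have lt_m : (m < (m * p).+1)%N by rewrite ltnS leq_pmulr.
  rewrite (bigD1 (Ordinal lt_m)) //= eqxx mulr1 mulnK // big1 ?addr0 // => i.
  rewrite eqn_pmul2r // => /eqP ni; case: eqP => [mi|]; rewrite ?mulr0 //.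
  by case: ni; apply: val_inj.
rewrite big1 // => i _; case: eqP => [ni|_]; last exact: mulr0.
by rewrite ni dvdn_mull in np.
Qed.

Lemma fps_sec_FrobeniusM r f g : (r < p)%N ->
  fps_sec p r (f ^+ p * g) = f * fps_sec p r g.
Proof. by rewrite fps_Frobenius; apply: fps_sec_dilM. Qed.

End Frobenius.

(** * The 3-dissection of psi modulo 3 *)

Lemma tri_mul3D1 i : tri (3 * i + 1) = (9 * tri i + 1)%N.
Proof. by have := tri_double (3 * i + 1); have := tri_double i; nia. Qed.

(** Splitting on m mod 3 shows that the terms of psi with exponent 1 mod 3 form q psi(q^9), and that
    none has exponent 2 mod 3. *)
Lemma tri_mod3 m k r : tri m = (3 * k + r)%N -> (r < 3)%N ->
  r = 0%N \/ r = 1%N /\ exists2 i, m = (3 * i + 1)%N & k = (3 * tri i)%N.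
Proof.
move=> eq_m lt_r3; have := tri_double m; rewrite eq_m.
have -> : m = (3 * (m %/ 3) + m %% 3)%N by rewrite mulnC -divn_eq.
have : (m %% 3 < 3)%N by rewrite ltn_mod.
case: (m %% 3)%N eq_m => [|[|[|//]]] eq_m _ eq2; first by left; lia.
  have ? := tri_double (m %/ 3); have r1 : r = 1%N by lia.
  by right; split=> //; exists (m %/ 3)%N => //; lia.
by left; lia.
Qed.

Local Notation psi := (theta (fun=> 1) : fps 'F_3).

Lemma coef_psi_mul9D1 n : coef psi (9 * n + 1) = coef psi n.
Proof.
case: (boolP [exists i : 'I_n.+1, n == tri i]) => [/existsP[i /eqP eq_i]|/existsPn ntri].
  by rewrite [in RHS]eq_i [in LHS]eq_i -tri_mul3D1 !coef_theta_tri.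
have ntriP k : n <> tri k.
  move=> eq_n; have lt_k : (k < n.+1)%N by rewrite ltnS eq_n leq_tri.
  by have /eqP := ntri (Ordinal lt_k).
rewrite [RHS]coef_theta_eq0 => [|k /ntriP //]; apply: coef_theta_eq0 => m eq_m.
have [|//|[_ [i _ eq_i]]] := @tri_mod3 m (3 * n) 1 _ isT; first by lia.
by case: (ntriP i); lia.
Qed.

Lemma coef_psi_3D1 k : coef psi (3 * k + 1) = if (3 %| k)%N then coef psi (k %/ 3) else 0.
Proof.
case: ifP => [/dvdnP[j ->]|nk].
  by rewrite mulnK // -(coef_psi_mul9D1 j); congr coef; lia.
apply: coef_theta_eq0 => m eq_m.
have [//|[_ [i _ eq_i]]] := @tri_mod3 m k 1 (esym eq_m) isT.
by rewrite eq_i dvdn_mulr in nk.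
Qed.

Lemma coef_psi_3D2 k : coef psi (3 * k + 2) = 0.
Proof.
by apply: coef_theta_eq0 => m eq_m; case: (@tri_mod3 m k 2 (esym eq_m) isT) => // -[].
Qed.

(** Over F_3, cubes and ninth powers are the substitutions of q^3 and q^9 for q, so the summands are
    the parts of psi in classes 0 and 1 mod 3. *)
Lemma psi_dissect : psi = fps_sec 3 0 psi ^+ 3 + 'q * psi ^+ 9.
Proof.
rewrite (exprM psi 3 3) !(@fps_Frobenius 3) //; apply: fpsP => n.
rewrite coef_fpsD coef_fpsXM.
have [k [r [lt_r3 ->]]] : exists k r, (r < 3)%N /\ n = (3 * k + r)%N.
  by exists (n %/ 3)%N, (n %% 3)%N; rewrite ltn_mod mulnC -divn_eq.
case: r lt_r3 => [|[|[|r]]] // _.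
- rewrite addn0 coef_fps_dilM // coef_fps_sec addn0.
  case: k => [|k]; first by rewrite muln0 addr0.
  by rewrite mulnS [X in _ + X]coef_fps_dil0 ?addr0 //; lia.
- rewrite addn1 coef_fps_dilM // [X in X + _]coef_fps_dil0 ?add0r.
    by rewrite -(addn1 (3 * k)) coef_psi_3D1.
  by lia.
rewrite coef_psi_3D2 addn2 !coef_fps_dil0 ?addr0 //.
  by lia.
by lia.
Qed.

Lemma sec_psi2 : fps_sec 3 2 (psi ^+ 2) = psi ^+ 6.
Proof.
(* The squared dissection, each term a cube times 1, 2q or q^2; only q^2 meets class 2 mod 3. *)
have -> : psi ^+ 2 = fps_sec 3 0 psi ^+ 3 * (fps_sec 3 0 psi ^+ 3 * 1)
    + (psi ^+ 3) ^+ 3 * (fps_sec 3 0 psi ^+ 3 * (2 * 'q))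
    + (psi ^+ 6) ^+ 3 * ('q ^+ 2).
  by rewrite {1}psi_dissect -!exprM; ring.
rewrite !fps_secD !(@fps_sec_FrobeniusM 3) //.
have s0 : fps_sec 3 2 1 = 0 :> fps 'F_3.
  by apply: fpsP => n; rewrite coef_fps_sec coef_fps1 addn2.
have s1 : fps_sec 3 2 (2 * 'q) = 0 :> fps 'F_3.
  by apply: fpsP => n; rewrite coef_fps_sec (fpsC_nat _ 2) coef_fpsCM /= addn2 mulr0.
have s2 : fps_sec 3 2 ('q ^+ 2) = 1 :> fps 'F_3.
  apply: fpsP => n; rewrite coef_fps_sec coef_fpsXn coef_fps1.
  by congr (nat_of_bool _)%:R; lia.
by rewrite s0 s1 s2 !mulr0 !add0r mulr1.
Qed.

Lemma coef_psi26 n : coef (psi ^+ 26) (27 * n + 26) = 0.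
Proof.
have e1 : fps_sec 3 2 (psi ^+ 26) = psi ^+ 14.
  by rewrite (exprD psi (8 * 3) 2) exprM fps_sec_FrobeniusM // sec_psi2 -exprD.
have e2 : fps_sec 3 2 (psi ^+ 14) = psi ^+ 10.
  by rewrite (exprD psi (4 * 3) 2) exprM fps_sec_FrobeniusM // sec_psi2 -exprD.
have e3 : fps_sec 3 2 (psi ^+ 10) = 0.
  rewrite (exprD psi (3 * 3) 1) exprM fps_sec_FrobeniusM // expr1.
  rewrite (_ : fps_sec 3 2 psi = 0) ?mulr0 //; apply: fpsP; exact: coef_psi_3D2.
(* As 26 = 2 + 3*2 + 9*2, taking class 2 mod 3 three times takes class 26 mod 27. *)
have := congr1 (fun f => coef f n) e3; rewrite -e2 -e1 coef_fps0 => <-.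
by rewrite !coef_fps_sec; congr coef; lia.
Qed.

(* [psi^27 M = psi^26 S], where [psi^27] is a series in [q^27] and [psi^26] has
   no terms [q^(27n+26)]. *)
Lemma psi_quotient_coef (M S : fps 'F_3) (s N : nat) :
  psi * M = S -> (forall n, (n %% 27 != s)%N -> coef S n = 0) ->
  coef M (27 * N + (s + 26) %% 27) = 0.
Proof.
set r := ((s + 26) %% 27)%N => psiM S0; have lt_r : (r < 27)%N by rewrite ltn_mod.
(* Takes class [r] mod 27 through the three base-3 digits of [r]; at each stage psi^27 leaves as a
   cube. *)
pose sec3 (f : fps 'F_3) :=
  fps_sec 3 (r %/ 9) (fps_sec 3 ((r %/ 3) %% 3) (fps_sec 3 (r %% 3) f)).
have coef_sec3 (f : fps 'F_3) n : coef (sec3 f) n = coef f (27 * n + r).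
  by rewrite /sec3 !coef_fps_sec; congr coef; lia.
have secM : sec3 (psi ^+ 27 * M) = psi * sec3 M.
  rewrite /sec3 (exprM _ 3 9) (exprM _ 3 3).
  by rewrite !(@fps_sec_FrobeniusM 3) // ?ltn_mod // ltn_divLR.
have sec0 : sec3 (psi ^+ 27 * M) = 0.
  apply: fpsP => n; rewrite coef_sec3 exprSr -mulrA psiM coef_fpsM big1 // => i _.
  (* The two exponents add up to s + 26 mod 27, so exponent s in [S] forces exponent 26 in
     psi^26. *)
  have [Si|/S0 ->] := eqVneq ((27 * n + r - i) %% 27)%N s; last by rewrite mulr0.
  have lt_i := ltn_ord i.
  rewrite (_ : nat_of_ord i = 27 * (i %/ 27) + 26)%N ?coef_psi26 ?mul0r //.
  by rewrite /r in Si lt_i *; lia.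
have u : psi \is a GRing.unit by rewrite qualifE /= /fps_unit (coef_theta_tri _ 0%N).
by rewrite -coef_sec3 -[sec3 M](mulKr u) -secM sec0 mulr0.
Qed.

(** * Binomial coefficients modulo 3, and the conclusion *)

Lemma dvd3_bin N k : (3 %| 'C(N %% 9, k %% 9))%N -> (3 %| 'C(N, k))%N.
Proof.
have lt_r9 : (N %% 9 < 9)%N by rewrite ltn_mod.
rewrite {2}(divn_eq N 9); elim: (N %/ 9)%N k => [|m IHm] k C0.
  rewrite add0n; have [lt_k9|le_9k] := ltnP k 9.
    by rewrite (modn_small lt_k9) in C0.
  by rewrite bin_small // (leq_trans lt_r9).
(* Since (1+x)^9 = 1 + x^9 modulo 3, only i = 0 and i = 9 matter, and both preserve the lower index
   mod 9. *)
rewrite mulSn -addnA -binomial.Vandermonde; apply: dvdn_sum => -[i lt_ik] _ /=.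
have [->|i_neq0] := eqVneq i 0%N; first by rewrite bin0 mul1n subn0 IHm.
have [i9|i_neq9] := eqVneq i 9%N.
  rewrite i9 binn mul1n IHm //; move: C0; congr (3 %| 'C(_, _))%N; lia.
by apply: dvdn_mulr; case: i {lt_ik} i_neq0 i_neq9 => [|[|[|[|[|[|[|[|[|[|i]]]]]]]]]].
Qed.

Lemma theta_support t s :
  (forall k, (tri k %% 27 != s)%N -> (3 %| 'C((k + t) %% 9, t.*2 %% 9))%N) ->
  forall n, (n %% 27 != s)%N ->
    coef (theta (fun n => ('C(n + t, t.*2))%:R) : fps 'F_3) n = 0.
Proof.
move=> C0 n ns; apply: coef_theta_eq0 => k eq_n; apply/eqP.
by rewrite -(dvdn_pcharf (pchar_Fp (isT : prime 3))) dvd3_bin // C0 // -eq_n.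
Qed.

Lemma MO_eq0_mod3 t s N :
  (forall k, (tri k %% 27 != s)%N -> (3 %| 'C((k + t) %% 9, t.*2 %% 9))%N) ->
  (MO (-1) t (27 * N + (s + 26) %% 27)%N = 0 %[mod 3])%Z.
Proof.
move=> C0.
have a2 : (-1)%:~R = 2 :> fps 'F_3.
  apply/eqP; rewrite -subr_eq0; apply/eqP.
  transitivity (- (3%:R) : fps 'F_3); first by ring.
  by rewrite (pcharf0 (pchar_fps_Fp (isT : prime 3))) oppr0.
have /= M0 := psi_quotient_coef N (MO_theta t a2) (theta_support C0).
apply/eqP; rewrite eqz_mod_dvd subr0 (dvdz_pcharf (pchar_Fp (isT : prime 3))).
exact/eqP.
Qed.

Theorem theorem4p4 (J N : nat) :
  (MO (-1) (9 * J + 4)%N (27 * N + 9)%N = 0 %[mod 3])%Z /\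
  (MO (-1) (9 * J + 7)%N (27 * N)%N = 0 %[mod 3])%Z.
Proof.
have split9 k : exists m j, (j < 9)%N /\ k = (9 * m + j)%N.
  by exists (k %/ 9)%N, (k %% 9)%N; rewrite ltn_mod mulnC -divn_eq.
split.
  (* For r < 9, C(r,8) is nonzero only at r = 8, so j = 4, and tri(9m+4) = 81 tri(m) + 10. *)
  apply: (@MO_eq0_mod3 _ 10) => k; have [m [j [lt_j9 ->]]] := split9 k.
  have := tri_double (9 * m + j).
  rewrite (_ : (9 * J + 4).*2 %% 9 = 8)%N; last by lia.
  rewrite (_ : (9 * m + j + (9 * J + 4)) %% 9 = (j + 4) %% 9)%N; last by lia.
  by case: j lt_j9 => [|[|[|[|[|[|[|[|[|j]]]]]]]]] // _; lia.
rewrite -[(27 * N)%N]addn0.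
(* For r < 9, C(r,5) is prime to 3 only at r = 5 and r = 8, so j = 7 or j = 1; both tri(9m+7) and
   tri(9m+1) are 1 mod 27. *)
apply: (@MO_eq0_mod3 _ 1) => k; have [m [j [lt_j9 ->]]] := split9 k.
have := tri_double (9 * m + j).
rewrite (_ : (9 * J + 7).*2 %% 9 = 5)%N; last by lia.
rewrite (_ : (9 * m + j + (9 * J + 7)) %% 9 = (j + 7) %% 9)%N; last by lia.
by case: j lt_j9 => [|[|[|[|[|[|[|[|[|j]]]]]]]]] // _; lia.
Qed.
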